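(* Let $m,n\ge 1$, $\mathbf{A}=[A_{ij}]\in\mathbb{R}^{m\times n}$, $\mathbf{b}\in\mathbb{R}^m$, $J=\{1,\dots,n\}$ and $0<p<\infty$. Then the error function $E_p:2^J\to\mathbb{R}$ associated with $(\mathbf{A},\mathbf{b})$ is decreasing and supermodular.
   Context: The principal solution $\hat{\mathbf{x}}\in\mathbb{R}^n$ of the max-plus equation $\max_j(A_{ij}+x_j)=b_i$ $(i=1,\dots,m)$ is $\hat x_j=\min_{1\le i\le m}(b_i-A_{ij})$ for $j\in J$. It satisfies $\max_{j\in J}(A_{ij}+\hat x_j)\le b_i$ for all $i$. The error vector $\mathbf{e}(T)=(e_1(T),\dots,e_m(T))^\intercal\in\mathbb{R}^m$ of a subset $T\subseteq J$ is defined by $e_i(T)=b_i-\max_{j\in T}(A_{ij}+\hat x_j)$ if $T\neq\emptyset$, and $e_i(\emptyset)=\max_{j\in J}e_i(\{j\})$. All $e_i(T)$ are non-negative. The error function is $E_p(T)=\|\mathbf{e}(T)\|_p^p=\sum_{i=1}^m (e_i(T))^p$. A set function $f:2^J\to\mathbb{R}$ is decreasing if $f(B)\le f(C)$ whenever $C\subseteq B\subseteq J$ (non-strict). It is submodular if $f(C\cup\{k\})-f(C)\ge f(B\cup\{k\})-f(B)$ for all $C\subseteq B\subseteq J$ and $k\in J\setminus B$. It is supermodular if $-f$ is submodular. *)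

(* Defs.v *)
From mathcomp Require Import all_boot all_order all_algebra.
From mathcomp Require Import all_classical all_reals all_analysis.

Set Implicit Arguments.
Unset Strict Implicit.
Unset Printing Implicit Defensive.

Import Order.TTheory GRing.Theory Num.Theory.
Local Open Scope ring_scope.

(* The picked element of T only serves as the starting value of the fold, so
   that no artificial bottom or top element interferes; for T != set0 the
   result is the actual maximum (minimum) of F on T (see set_maxP, set_minP).
   The value 0 on set0 is a dummy that is never used below. *)
Definition set_max (R : realType) (I : finType) (T : {set I}) (F : I -> R) : R :=
  if [pick j in T] is Some j0 then \big[Num.max/F j0]_(j in T) F j else 0.

Definition set_min (R : realType) (I : finType) (T : {set I}) (F : I -> R) : R :=
  if [pick j in T] is Some j0 then \big[Num.min/F j0]_(j in T) F j else 0.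

Lemma set_maxP (R : realType) (I : finType) (T : {set I}) (F : I -> R) :
  T != finset.set0 ->
  (exists2 j, j \in T & set_max T F = F j) /\
  (forall j, j \in T -> F j <= set_max T F).
Proof.
move=> T0; rewrite /set_max; case: pickP => [j0 j0T|T_empty]; last first.
  by case/set0Pn: T0 => j; rewrite T_empty.
split; last by move=> j jT; exact: le_bigmax_cond.
apply: (big_ind (fun x => exists2 j, j \in T & x = F j)).
- by exists j0.
- move=> x y [j jT ->] [k kT ->].
  by case: (leP (F j) (F k)) => _; [exists k|exists j].
- by move=> j jT; exists j.
Qed.

Lemma set_minP (R : realType) (I : finType) (T : {set I}) (F : I -> R) :
  T != finset.set0 ->
  (exists2 j, j \in T & set_min T F = F j) /\
  (forall j, j \in T -> set_min T F <= F j).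
Proof.
move=> T0; rewrite /set_min; case: pickP => [j0 j0T|T_empty]; last first.
  by case/set0Pn: T0 => j; rewrite T_empty.
split; last by move=> j jT; exact: bigmin_le_cond.
apply: (big_ind (fun x => exists2 j, j \in T & x = F j)).
- by exists j0.
- move=> x y [j jT ->] [k kT ->].
  by case: (leP (F j) (F k)) => _; [exists j|exists k].
- by move=> j jT; exists j.
Qed.

Definition principal_solution (R : realType) (m n : nat)
    (A : 'M[R]_(m, n)) (b : 'cV[R]_m) : 'cV[R]_n :=
  \col_j set_min [set: 'I_m]%SET (fun i => b i 0 - A i j).

Definition residual (R : realType) (m n : nat)
    (A : 'M[R]_(m, n)) (b : 'cV[R]_m) (T : {set 'I_n}) (i : 'I_m) : R :=
  b i 0 - set_max T (fun j => A i j + principal_solution A b j 0).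

Definition error_vector (R : realType) (m n : nat)
    (A : 'M[R]_(m, n)) (b : 'cV[R]_m) (T : {set 'I_n}) : 'cV[R]_m :=
  \col_i (if T == finset.set0
          then set_max [set: 'I_n]%SET (fun j => residual A b [set j]%SET i)
          else residual A b T i).

(* The entries of the error vector are nonnegative when m, n >= 1, so no
   absolute value is needed and powR is only used on [0, +oo[. *)
Definition error_function (R : realType) (m n : nat)
    (A : 'M[R]_(m, n)) (b : 'cV[R]_m) (p : R) (T : {set 'I_n}) : R :=
  \sum_(i < m) error_vector A b T i 0 `^ p.

Definition set_decreasing (R : realType) (I : finType) (f : {set I} -> R) : Prop :=
  forall B C : {set I}, C \subset B -> f B <= f C.

Definition submodular (R : realType) (I : finType) (f : {set I} -> R) : Prop :=
  forall (B C : {set I}) (k : I), C \subset B -> k \notin B ->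
    f (k |: B)%SET - f B <= f (k |: C)%SET - f C.

Definition supermodular (R : realType) (I : finType) (f : {set I} -> R) : Prop :=
  submodular (fun T => - f T).

(* Main.v *)
Require Import Defs.
From mathcomp Require Import all_boot all_order all_algebra.
From mathcomp Require Import all_classical all_reals all_analysis.
From mathcomp Require Import lra.

Import Order.TTheory GRing.Theory Num.Theory.
Local Open Scope ring_scope.

(** Write [d i j] for the error [residual A b [set j] i] of the single column
    [j] in row [i], and [D i] for the largest of the [d i j] over all columns.
    Subtracting a maximum from [b i] gives a minimum, so the error of row [i] on
    a nonempty [T] is the minimum of the [d i j] with [j] in [T].  The convention
    chosen on the empty set makes the error there equal to [D i]; since [D i] is
    at least every [d i j], taking the minimum of [D i] and the [d i j] gives the
    error on every [T], empty or not ([error_vectorE]).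

    The principal solution makes all [d i j] nonnegative ([residual1_ge0]), and
    [x |-> x `^ p] is nondecreasing on nonnegative reals, so it commutes with
    minima there ([powR_bigmin]).  Each summand of the error function is thus a
    function [T |-> min (z, min_(j in T) F j)].  Such a function is decreasing,
    and it is supermodular: adding [k] to [T] changes its value [t] by
    [min (F k, t) - t = min (F k - t, 0)], which is nonincreasing in [t], while
    [t] decreases as [T] grows.  Both properties survive summation over the
    rows. *)

Lemma bigmin_decreasing (R : realType) (I : finType) (z : R) (F : I -> R) :
  set_decreasing (fun T : {set I} => \big[Num.min/z]_(j in T) F j).
Proof.
move=> B C sCB; apply: sub_bigmin => j; exact: (fintype.subsetP sCB).
Qed.

(** The marginal value of [k] at a set of value [t] is [min (F k - t, 0)], so it
    depends on the set only through [t], in a nonincreasing way; the claim then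
    follows from [bigmin_decreasing]. *)
Lemma bigmin_supermodular (R : realType) (I : finType) (z : R) (F : I -> R) :
  supermodular (fun T : {set I} => \big[Num.min/z]_(j in T) F j).
Proof.
move=> B C k sCB _ /=.
rewrite !bigminU !bigmin_set1 -!minA -!bigmin_idl.
have := bigmin_decreasing R I z F B C sCB.
move: (\big[_/_]_(j in B) _) (\big[_/_]_(j in C) _) => y x yx.
by case: (leP (F k) x); case: (leP (F k) y); lra.
Qed.

Lemma sum_decreasing (R : realType) (I J : finType) (f : J -> {set I} -> R) :
  (forall i, set_decreasing (f i)) ->
  set_decreasing (fun T => \sum_i f i T).
Proof. by move=> df B C sCB; apply: ler_sum => i _; exact: df. Qed.

Lemma sum_supermodular (R : realType) (I J : finType) (f : J -> {set I} -> R) :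
  (forall i, supermodular (f i)) ->
  supermodular (fun T => \sum_i f i T).
Proof.
move=> sf B C k sCB kB; rewrite -!sumrN -!big_split /=.
by apply: ler_sum => i _; exact: sf.
Qed.

Lemma powR_bigmin (R : realType) (I : finType) (P : pred I) (p z : R)
    (F : I -> R) : 0 <= p -> 0 <= z -> (forall j, 0 <= F j) ->
  (\big[Num.min/z]_(j | P j) F j) `^ p = \big[Num.min/z `^ p]_(j | P j) F j `^ p.
Proof.
move=> p0 z0 F0.
(* Nonnegativity of the partial minima has to be carried along the induction. *)
suff [] : 0 <= \big[Num.min/z]_(j | P j) F j /\
    (\big[Num.min/z]_(j | P j) F j) `^ p =
    \big[Num.min/z `^ p]_(j | P j) F j `^ p by [].
apply: (big_ind2 (fun x y => 0 <= x /\ x `^ p = y)) => //.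
move=> x _ y _ [x0 <-] [y0 <-].
case: (leP x y) => [xy|/ltW yx]; split=> //.
- by rewrite min_l // ge0_ler_powR.
- by rewrite min_r // ge0_ler_powR.
Qed.

Lemma residual1 (R : realType) (m n : nat) (A : 'M[R]_(m, n)) (b : 'cV[R]_m)
    (i : 'I_m) (j : 'I_n) :
  residual A b [set j]%SET i = b i 0 - (A i j + principal_solution A b j 0).
Proof.
rewrite /residual; congr (_ - _).
have j0 : [set j]%SET != finset.set0 by apply/set0Pn; exists j; rewrite inE.
by have [[k /set1P -> ->] _] := set_maxP
  (fun j => A i j + principal_solution A b j 0) j0.
Qed.

(** Row [i] competes in the minimum that defines the [j]-th entry of the principal
    solution, so that entry is at most [b i 0 - A i j]. *)
Lemma residual1_ge0 (R : realType) (m n : nat) (A : 'M[R]_(m, n))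
    (b : 'cV[R]_m) (i : 'I_m) (j : 'I_n) : 0 <= residual A b [set j]%SET i.
Proof.
rewrite residual1 mxE.
have i0 : [set: 'I_m]%SET != finset.set0 by apply/set0Pn; exists i; rewrite inE.
have [_ /(_ i)] := set_minP (fun i => b i 0 - A i j) i0.
by rewrite inE opprD addrA subr_ge0 => /(_ isT).
Qed.

Lemma residual1_le_max (R : realType) (m n : nat) (A : 'M[R]_(m, n))
    (b : 'cV[R]_m) (i : 'I_m) (j : 'I_n) :
  residual A b [set j]%SET i <=
  set_max [set: 'I_n]%SET (fun j => residual A b [set j]%SET i).
Proof.
have J0 : [set: 'I_n]%SET != finset.set0 by apply/set0Pn; exists j; rewrite inE.
by have [_] := set_maxP (fun j => residual A b [set j]%SET i) J0; apply.
Qed.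

(** The starting value of the fold is the value prescribed on the empty set; it
    dominates every column error, hence is invisible on nonempty sets. *)
Lemma error_vectorE (R : realType) (m n : nat) (A : 'M[R]_(m, n))
    (b : 'cV[R]_m) (T : {set 'I_n}) (i : 'I_m) :
  error_vector A b T i 0 =
  \big[Num.min/set_max [set: 'I_n]%SET (fun j => residual A b [set j]%SET i)]_(j in T)
     residual A b [set j]%SET i.
Proof.
rewrite mxE; case: ifPn => [/eqP -> |T0]; first by rewrite big_set0.
have [[k kT Ek] maxT] := set_maxP
  (fun j => A i j + principal_solution A b j 0) T0.
have resT : residual A b T i = residual A b [set k]%SET i.
  by rewrite residual1 /residual Ek.
apply/le_anti/andP; split; last by rewrite resT; exact: bigmin_le_cond.
apply: le_bigmin => [|j jT]; first by rewrite resT residual1_le_max.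
by rewrite residual1 /residual lerD2l lerN2 maxT.
Qed.

Lemma error_functionE (R : realType) (m n : nat) (A : 'M[R]_(m, n))
    (b : 'cV[R]_m) (p : R) : (0 < n)%N -> 0 <= p ->
  error_function A b p = fun T : {set 'I_n} => \sum_(i < m)
    \big[Num.min/set_max [set: 'I_n]%SET
                   (fun j => residual A b [set j]%SET i) `^ p]_(j in T)
      residual A b [set j]%SET i `^ p.
Proof.
move=> n0 p0; apply: funext => T; apply: eq_bigr => i _.
rewrite error_vectorE powR_bigmin // => [|j]; last exact: residual1_ge0.
exact: le_trans (residual1_ge0 _ _ _ A b i (Ordinal n0)) (residual1_le_max _ _ _ _ _ _ _).
Qed.

Theorem theorem1 (R : realType) (m n : nat) (hm : (0 < m)%N) (hn : (0 < n)%N)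
    (A : 'M[R]_(m, n)) (b : 'cV[R]_m) (p : R) (hp : 0 < p) :
  set_decreasing (error_function A b p) /\ supermodular (error_function A b p).
Proof.
rewrite error_functionE ?ltW //; split.
- by apply: sum_decreasing => i; exact: bigmin_decreasing.
- by apply: sum_supermodular => i; exact: bigmin_supermodular.
Qed.
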